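(* Let $G$ be the communication graph of a system, and let $F_1=(f_1,g_1)$ and $F_2=(f_2,g_2)$ be two different synchronization schedules on $G$. Then the synchronized communication system on $G$ using $F_1$ has the same uncovering-resilience as the synchronized communication system on $G$ using $F_2$.
   Context: Model. A system consists of pairwise disjoint unit circles $C_1,\dots,C_n$ in the plane (trajectories) and a communication range $r>0$. Its communication graph $G$ has vertex set $\{C_1,\dots,C_n\}$, $C_i,C_j$ adjacent iff the distance between their centres is at most $2+r$. Positions on a circle are angles (mod $2\pi$). For an edge $(i,j)$, the link position $\phi_{ij}$ is the angle of the point of $C_i$ closest to $C_j$. A schedule $F=(f,g)$ assigns each circle a starting angle $f(C_i)\in[0,2\pi)$ and direction $g(C_i)\in\{1,-1\}$ ($1$ = counterclockwise); a robot following it on $C_i$ is at $f(C_i)+g(C_i)2\pi t$ at time $t$. $F$ is a synchronization schedule if $g(C_i)=-g(C_j)$ for adjacent circles and robots following $F$ on adjacent $C_i,C_j$ are at $\phi_{ij},\phi_{ji}$ at exactly the same times. A synchronized communication system (SCS) on $G$ consists of $n$ robots, initially one per circle, following a synchronization schedule, with the switching rule: when a robot on $C_i$ reaches $\phi_{ij}$ and $C_j$ is empty, it instantly passes to $C_j$ and from then on follows the schedule of $C_j$; if $C_j$ has a robot, they meet and each stays on its circle. A partial SCS arises by letting some robots leave (possibly at different times). A circle is covered if every point of it is visited periodically by the surviving robots. The uncovering-resilience of an SCS is the largest $k$ such that, whichever $k$ robots leave, all circles remain covered. *)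

(* Defs.v *)
From mathcomp Require Import all_boot.
From Stdlib Require Import Reals.

Set Implicit Arguments.
Unset Strict Implicit.
Unset Printing Implicit Defensive.

Local Open Scope R_scope.

Definition point := (R * R)%type.

Definition dist (p q : point) : R :=
  sqrt ((fst p - fst q) ^ 2 + (snd p - snd q) ^ 2).

(* A system: n unit circles with centres c : 'I_n -> point, range r. *)
Definition valid_system (n : nat) (c : 'I_n -> point) (r : R) : Prop :=
  0 < r /\ (forall i j : 'I_n, i <> j -> 2 < dist (c i) (c j)).

Definition adj (n : nat) (c : 'I_n -> point) (r : R) (i j : 'I_n) : Prop :=
  i <> j /\ dist (c i) (c j) <= 2 + r.

Definition circ_pt (n : nat) (c : 'I_n -> point) (i : 'I_n) (a : R) : point :=
  (fst (c i) + cos a, snd (c i) + sin a).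

(* Link position phi_ij: the point of C_i closest to C_j. *)
Definition link (n : nat) (c : 'I_n -> point) (i j : 'I_n) : point :=
  (fst (c i) + (fst (c j) - fst (c i)) / dist (c i) (c j),
   snd (c i) + (snd (c j) - snd (c i)) / dist (c i) (c j)).

Definition spos (n : nat) (c : 'I_n -> point) (f g : 'I_n -> R) (i : 'I_n) (t : R)
  : point := circ_pt c i (f i + g i * 2 * PI * t).

Definition is_schedule (n : nat) (f g : 'I_n -> R) : Prop :=
  forall i, (0 <= f i < 2 * PI) /\ (g i = 1 \/ g i = -1).

Definition is_sync_schedule (n : nat) (c : 'I_n -> point) (r : R) (f g : 'I_n -> R)
  : Prop :=
  is_schedule f g /\
  forall i j, adj c r i j ->
    g i = - g j /\
    (forall t, 0 <= t -> (spos c f g i t = link c i j <-> spos c f g j t = link c j i)).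

Definition linked (n : nat) (c : 'I_n -> point) (r : R) (f g : 'I_n -> R)
  (t : R) (i j : 'I_n) : Prop :=
  adj c r i j /\ spos c f g i t = link c i j.

(* Switching at time t, from occupancy S to occupancy S' (sets of occupied
   circles).  Every robot either stays or passes to a linked empty circle;
   a robot that stays cannot have a linked empty circle which is not taken
   by another robot at the same instant.  (Nondeterminism only arises in the
   degenerate case where several link positions on one circle coincide.) *)
Definition switch_step (n : nat) (c : 'I_n -> point) (r : R) (f g : 'I_n -> R)
  (t : R) (S S' : {set 'I_n}) : Prop :=
  exists sigma : 'I_n -> 'I_n,
    {in S &, injective sigma} /\
    S' = sigma @: S /\
    (forall i, i \in S ->
       sigma i = i \/ (linked c r f g t i (sigma i) /\ sigma i \notin S)) /\
    (forall i, i \in S -> sigma i = i ->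
       forall j, linked c r f g t i j -> j \in S \/ j \in sigma @: S).

(* S is the occupancy just before time t (left limit; all circles occupied
   initially). st t is the occupancy just after time t. *)
Definition state_before (n : nat) (st : R -> {set 'I_n}) (t : R) (S : {set 'I_n})
  : Prop :=
  (t = 0 /\ S = setT) \/
  (0 < t /\ exists eps, 0 < eps /\ forall s, t - eps < s < t -> st s = S).

(* A run of a (partial) SCS using schedule (f,g): occupancy is piecewise
   constant; at every instant robots may leave (just before or just after
   the switching), and the switching rule is applied. *)
Definition scs_run (n : nat) (c : 'I_n -> point) (r : R) (f g : 'I_n -> R)
  (st : R -> {set 'I_n}) : Prop :=
  (forall t, 0 <= t ->
     exists eps, 0 < eps /\ forall s, t <= s < t + eps -> st s = st t) /\
  (forall t, 0 <= t ->
     exists S, state_before st t S /\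
     exists L1 L2 S1, switch_step c r f g t (S :\: L1) S1 /\ st t = S1 :\: L2).

Definition departures (n : nat) (st : R -> {set 'I_n}) (k : nat) : Prop :=
  exists T, 0 <= T /\ forall t, T <= t -> #|st t| = (n - k)%nat.

Definition covered (n : nat) (c : 'I_n -> point) (f g : 'I_n -> R)
  (st : R -> {set 'I_n}) (i : 'I_n) : Prop :=
  forall a T : R, exists t, T <= t /\ spos c f g i t = circ_pt c i a /\
    (i \in st t \/ exists S, state_before st t S /\ i \in S).

Definition survives (n : nat) (c : 'I_n -> point) (r : R) (f g : 'I_n -> R)
  (k : nat) : Prop :=
  forall st, scs_run c r f g st -> departures st k -> forall i, covered c f g st i.

Definition is_uncovering_resilience (n : nat) (c : 'I_n -> point) (r : R)
  (f g : 'I_n -> R) (k : nat) : Prop :=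
  (k <= n)%nat /\ survives c r f g k /\
  forall k', (k' <= n)%nat -> survives c r f g k' -> (k' <= k)%nat.

(* Main.v *)
(* For occupancies the switching rule is an involution [swap t] of the circles: linked
   circles exchange their contents, because a synchronized graph is bipartite and so no
   circle is linked to two others at once. Tokens carried by these involutions evolve by a
   flow with a monodromy [mu] over one period. The orbits of [mu] (the rings) travel
   together, and a circle becomes uncovered exactly when some ring has lost all its robots;
   hence [k] departures are survived iff every orbit has more than [k] elements.
   On each connected component, the second schedule is the first one with a shifted, and
   possibly reversed, clock, so its monodromy there is the first one or its inverse, which
   has the same orbits. *)
Require Import Defs.
From Stdlib Require Import ZArith Reals Lra Lia.
From mathcomp Require Import all_boot.
From mathcomp Require Import boolp.

Set Implicit Arguments.
Unset Strict Implicit.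
Unset Printing Implicit Defensive.

Local Open Scope R_scope.

(** * Local constancy and uniform radii *)

(** Real induction: the supremum [m] of the times up to which [h] keeps its initial value is reached
    by the left hypothesis and, if below [b], passed by the right one. *)
Lemma locally_constant (T : Type) (h : R -> T) (a : R) :
  (forall t, a <= t ->
     exists eps, 0 < eps /\ forall s, t <= s < t + eps -> h s = h t) ->
  (forall t, a < t ->
     exists eps, 0 < eps /\ forall s, a <= s -> t - eps < s < t -> h s = h t) ->
  forall t, a <= t -> h t = h a.
Proof.
move=> hr hl b ab.
pose E t := a <= t <= b /\ forall s, a <= s <= t -> h s = h a.
have Ea : E a by split=> [|s sa]; [lra | congr h; lra].
have [m [mub mlub]] : {m | is_lub E m}.
  by apply: completeness; [exists b => t [[]] | exists a].
have am : a <= m by exact: mub.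
have mb : m <= b by apply: mlub => t [] [].
have Ebelow s : a <= s < m -> h s = h a.
  move=> sm; case: (pselect (exists t, E t /\ s < t)) => [[t [[_ ht] st]]|no].
    by apply: ht; lra.
  suff : m <= s by lra.
  apply: mlub => t Et; case: (Rle_lt_dec t s) => // st; by case: no; exists t.
have hm : h m = h a.
  case: (Req_dec m a) => [-> //|ma].
  have [|eps [eps0 heps]] := hl m; first by lra.
  have := Rmax_l a (m - eps / 2); have := Rmax_r a (m - eps / 2).
  have ? : Rmax a (m - eps / 2) < m by apply: Rmax_lub_lt; lra.
  by move=> ? ?; rewrite -(heps (Rmax a (m - eps / 2))) ?Ebelow //; lra.
have [eps [eps0 heps]] := hr m am.
case: (Rle_lt_dec b m) => bm; first by have -> : b = m by lra.
have := Rmin_l b (m + eps / 2); have := Rmin_r b (m + eps / 2).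
have ? : m < Rmin b (m + eps / 2) by apply: Rmin_glb_lt; lra.
move=> ? ?; suff /mub : E (Rmin b (m + eps / 2)) by lra.
split=> [|s sb]; first by lra.
by case: (Rlt_le_dec s m) => sm; [apply: Ebelow | rewrite heps //]; lra.
Qed.

Lemma locally_constant2 (T : Type) (h : R -> T) :
  (forall t, exists eps, 0 < eps /\ forall s, t - eps < s < t + eps -> h s = h t) ->
  forall t t', h t = h t'.
Proof.
move=> hl.
suff le t t' : t <= t' -> h t' = h t.
  by move=> t t'; case: (Rle_lt_dec t t') => [/le // | /Rlt_le/le].
move: t'; apply: locally_constant => u _; have [eps [eps0 heps]] := hl u.
  by exists eps; split=> // v vu; apply: heps; lra.
by exists eps; split=> // v _ vu; apply: heps; lra.
Qed.

(** Finitely many admissible radii have a positive minimum, which is admissible for all elements by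
    downward closure. *)
Lemma uniform_eps (T : finType) (P : T -> R -> Prop) :
  (forall x d d', 0 < d' <= d -> P x d -> P x d') ->
  (forall x, exists d, 0 < d /\ P x d) -> exists d, 0 < d /\ forall x, P x d.
Proof.
move=> Pdown exP.
suff [d [d0 Pd]] : exists d, 0 < d /\ forall x, x \in enum T -> P x d.
  by exists d; split=> // x; apply: Pd; rewrite mem_enum.
elim: (enum T) => [|x s [d [d0 Pd]]]; first by exists 1; split=> //; lra.
have [e [e0 Pe]] := exP x.
have m0 : 0 < Rmin d e by apply: Rmin_glb_lt.
exists (Rmin d e); split=> // y; rewrite inE => /orP[/eqP-> | ys].
  by apply: Pdown Pe; split=> //; exact: Rmin_r.
by apply: Pdown (Pd y ys); split=> //; exact: Rmin_l.
Qed.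

(** * Integer translates and angles *)

Lemma floor_spec (x : R) : exists q : Z, IZR q <= x < IZR q + 1.
Proof.
have [? ?] := archimed x; exists (up x - 1)%Z; rewrite minus_IZR; lra.
Qed.

(** Integer translates of [x] are discrete: the gap is 1 for an integer [x], and otherwise the
    distance from [x] to the nearest integer. *)
Lemma translate_gap (x : R) :
  exists d, 0 < d /\ forall m : Z, x + IZR m = 0 \/ d <= Rabs (x + IZR m).
Proof.
have [q [xl xu]] := floor_spec x.
case: (Req_dec (IZR q) x) => qx.
  exists 1; split=> [|m]; first by lra.
  rewrite -qx -plus_IZR -abs_IZR.
  case: (Z.eq_dec (q + m) 0) => [-> | qm]; first by left.
  by right; apply: IZR_le; lia.
exists (Rmin (x - IZR q) (IZR q + 1 - x)); split=> [|m].
  by apply: Rmin_glb_lt; lra.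
right; have := Rmin_l (x - IZR q) (IZR q + 1 - x).
have := Rmin_r (x - IZR q) (IZR q + 1 - x).
case: (Z.le_gt_cases (- q) m) => qm.
  have : IZR (- q) <= IZR m by apply: IZR_le.
  by rewrite opp_IZR => ? ? ?; have := Rle_abs (x + IZR m); lra.
have : IZR m <= IZR (- q - 1) by apply: IZR_le; lia.
rewrite minus_IZR opp_IZR => ? ? ?.
by have := Rle_abs (- (x + IZR m)); rewrite Rabs_Ropp; lra.
Qed.

Lemma cos_sin_eq (x y : R) :
  cos x = cos y -> sin x = sin y -> exists m : Z, x = y + 2 * PI * IZR m.
Proof.
move=> cxy sxy.
have c1 : cos (x - y) = 1.
  by rewrite cos_minus cxy sxy; have := sin2_cos2 y; rewrite /Rsqr; lra.
have s0 : sin ((x - y) / 2) = 0.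
  have := cos_2a_sin ((x - y) / 2).
  have -> : 2 * ((x - y) / 2) = x - y by field.
  by rewrite c1 => ?; nra.
by have [m mE] := sin_eq_0_0 _ s0; exists m; lra.
Qed.

Lemma cos_sin_periodZ (x : R) (m : Z) :
  cos (x + 2 * PI * IZR m) = cos x /\ sin (x + 2 * PI * IZR m) = sin x.
Proof.
have nonneg y k : (0 <= k)%Z ->
    cos (y + 2 * PI * IZR k) = cos y /\ sin (y + 2 * PI * IZR k) = sin y.
  move=> /Z2Nat.id kE; rewrite -(cos_period y (Z.to_nat k)) -(sin_period y (Z.to_nat k)).
  by rewrite INR_IZR_INZ kE; split; congr (_ _); ring.
case: (Z.le_gt_cases 0 m) => m0; first exact: nonneg.
have [|<- <-] := nonneg (x + 2 * PI * IZR m) (- m)%Z; first by lia.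
by rewrite opp_IZR; split; congr (_ _); ring.
Qed.

Lemma unit_angle (x y : R) : x ^ 2 + y ^ 2 = 1 -> exists a, cos a = x /\ sin a = y.
Proof.
move=> xy.
have x1 : -1 <= x <= 1 by nra.
have c := cos_acos x x1; have s := sin_acos x x1.
have e : 1 - x² = y² by rewrite /Rsqr; lra.
rewrite e in s; case: (Rle_lt_dec 0 y) => y0.
  by exists (acos x); rewrite s sqrt_Rsqr.
by exists (- acos x); rewrite cos_neg sin_neg s c sqrt_Rsqr_abs Rabs_left //; split=> //; lra.
Qed.

(** * Geometry of links and times of link events *)

Section Schedule.

Variables (n : nat) (c : 'I_n -> point) (r : R).
Hypothesis sysP : valid_system c r.

Lemma dist_sym (p q : point) : Defs.dist p q = Defs.dist q p.
Proof. by rewrite /Defs.dist; congr sqrt; ring. Qed.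

Lemma adj_sym (i j : 'I_n) : adj c r i j -> adj c r j i.
Proof. by case=> ij dij; split; [exact: nesym | rewrite dist_sym]. Qed.

Lemma dist_gt2 (i j : 'I_n) : adj c r i j -> 2 < Defs.dist (c i) (c j).
Proof. by case: sysP => _ dP [ij _]; exact: dP. Qed.

Lemma dist_sq (p q : point) :
  Defs.dist p q * Defs.dist p q = (fst p - fst q) ^ 2 + (snd p - snd q) ^ 2.
Proof. by rewrite /Defs.dist sqrt_sqrt //; apply: Rplus_le_le_0_compat; exact: pow2_ge_0. Qed.

Lemma link_angle (i j : 'I_n) : adj c r i j -> exists a, link c i j = circ_pt c i a.
Proof.
move=> /dist_gt2 d2; have dE := dist_sq (c i) (c j).
rewrite /link /circ_pt; set d := Defs.dist _ _ in d2 dE *.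
have [|a [ca sa]] := @unit_angle ((fst (c j) - fst (c i)) / d) ((snd (c j) - snd (c i)) / d).
  have -> : forall u v, (u / d) ^ 2 + (v / d) ^ 2 = (u ^ 2 + v ^ 2) / (d * d).
    by move=> u v; field; lra.
  by rewrite dE; field; rewrite -dE; nra.
by exists a; rewrite ca sa.
Qed.

(** Equal link positions put both centres on one ray from [c i], at distances [a] and [b] in the
    interval from 2 to [2 + r]; the centres are then [Rabs (a - b)] apart, which is within range. *)
Lemma link_inj (i j k : 'I_n) :
  adj c r i j -> adj c r i k -> link c i j = link c i k -> j = k \/ adj c r j k.
Proof.
move=> ij ik [e1 e2]; have [r0 _] := sysP.
have dj := dist_gt2 ij; have dk := dist_gt2 ik.
case: ij ik => _ dj' [_ dk'].
case: (pselect (j = k)) => jk; [by left | right; split=> //].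
set a := Defs.dist (c i) (c j) in dj dj' e1 e2.
set b := Defs.dist (c i) (c k) in dk dk' e1 e2.
have sq := dist_sq (c i) (c j); rewrite -/a in sq.
rewrite /Defs.dist.
have -> : fst (c k) = fst (c i) + (fst (c k) - fst (c i)) / b * b by field; lra.
have -> : snd (c k) = snd (c i) + (snd (c k) - snd (c i)) / b * b by field; lra.
have -> : fst (c j) = fst (c i) + (fst (c j) - fst (c i)) / a * a by field; lra.
have -> : snd (c j) = snd (c i) + (snd (c j) - snd (c i)) / a * a by field; lra.
rewrite /link /= -/a -/b in e1 e2.
have -> : (fst (c k) - fst (c i)) / b = (fst (c j) - fst (c i)) / a by lra.
have -> : (snd (c k) - snd (c i)) / b = (snd (c j) - snd (c i)) / a by lra.
(* [(u, v)] is the common unit direction of the ray. *)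
set u := _ / a; set v := _ / a.
have uv : u ^ 2 + v ^ 2 = 1.
  have -> : u ^ 2 + v ^ 2 = ((fst (c i) - fst (c j)) ^ 2 + (snd (c i) - snd (c j)) ^ 2) / (a * a).
    by rewrite /u /v; field; lra.
  by rewrite -sq; field; lra.
have -> : (fst (c i) + u * a - (fst (c i) + u * b)) ^ 2 +
    (snd (c i) + v * a - (snd (c i) + v * b)) ^ 2 = Rsqr (a - b).
  by rewrite -[Rsqr _]Rmult_1_l -uv /Rsqr; ring.
by rewrite sqrt_Rsqr_abs; apply: Rabs_le; lra.
Qed.

Variables f g : 'I_n -> R.
Hypothesis syncP : is_sync_schedule c r f g.

Lemma dirP (i : 'I_n) : g i = 1 \/ g i = -1.
Proof. by case: syncP => sch _; case: (sch i). Qed.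

(** Every robot makes one full turn per unit of time, in either direction, so all positions have
    exact period 1. *)
Lemma spos_eq (i : 'I_n) (t t' : R) :
  spos c f g i t = spos c f g i t' <-> exists m : Z, t = t' + IZR m.
Proof.
split=> [[ec es]|[m ->]].
  have [||m mE] := @cos_sin_eq (f i + g i * 2 * PI * t) (f i + g i * 2 * PI * t').
  - by apply: Rplus_eq_reg_l ec.
  - by apply: Rplus_eq_reg_l es.
  have pi0 := PI_RGT_0; have {}mE : PI * (g i * (t - t') - IZR m) = 0 by lra.
  case: (Rmult_integral _ _ mE) => [|{}mE]; first by lra.
  case: (dirP i) => gi; rewrite gi in mE; [exists m | exists (- m)%Z; rewrite opp_IZR]; lra.
rewrite /spos /circ_pt; case: (dirP i) => ->.
  have -> : f i + 1 * 2 * PI * (t' + IZR m) = (f i + 1 * 2 * PI * t') + 2 * PI * IZR m by ring.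
  by have [-> ->] := cos_sin_periodZ (f i + 1 * 2 * PI * t') m.
have -> : f i + -1 * 2 * PI * t' = (f i + -1 * 2 * PI * (t' + IZR m)) + 2 * PI * IZR m by ring.
by have [-> ->] := cos_sin_periodZ (f i + -1 * 2 * PI * (t' + IZR m)) m.
Qed.

Lemma spos_shift (i : 'I_n) (t : R) (m : Z) : spos c f g i (t + IZR m) = spos c f g i t.
Proof. by apply/spos_eq; exists m. Qed.

Lemma spos_surj (i : 'I_n) (a : R) : exists t, spos c f g i t = circ_pt c i a.
Proof.
have pi0 := PI_RGT_0; rewrite /spos.
case: (dirP i) => ->; [exists ((a - f i) / (2 * PI)) | exists ((f i - a) / (2 * PI))];
  by congr circ_pt; field; lra.
Qed.

Lemma spos_link (i j : 'I_n) : adj c r i j -> exists t, spos c f g i t = link c i j.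
Proof. by move=> /link_angle[a ->]; exact: spos_surj. Qed.

(** Synchronization is assumed only at nonnegative times; subtracting the floor of [t] extends it to
    all real times, as needed once clocks are reversed. *)
Lemma link_sync (i j : 'I_n) (t : R) :
  adj c r i j -> spos c f g i t = link c i j -> spos c f g j t = link c j i.
Proof.
move=> ij; have [q [qt _]] := floor_spec t.
have t0 : 0 <= t + IZR (- q) by rewrite opp_IZR; lra.
case: syncP => _ /(_ _ _ ij)[_ /(_ _ t0)[H _]].
by rewrite -(spos_shift i t (- q)) -(spos_shift j t (- q)).
Qed.

Lemma linked_sym (t : R) (i j : 'I_n) : linked c r f g t i j -> linked c r f g t j i.
Proof. by case=> ij ti; split; [exact: adj_sym | exact: link_sync]. Qed.

(* Two neighbours of [i] linked to it at the same time lie in the same direction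
   from [i], hence are adjacent; but the directions [g] make the graph bipartite. *)
Lemma linked_fun (t : R) (i j k : 'I_n) :
  linked c r f g t i j -> linked c r f g t i k -> j = k.
Proof.
case=> ij ti [ik ti']; have [//|jk] := link_inj ij ik (etrans (esym ti) ti').
have [_ sP] := syncP; have [gij _] := sP _ _ ij; have [gik _] := sP _ _ ik.
have [gjk _] := sP _ _ jk; have := dirP i; lra.
Qed.

Lemma linked_shift (t : R) (m : Z) (i j : 'I_n) :
  linked c r f g (t + IZR m) i j <-> linked c r f g t i j.
Proof. by rewrite /linked spos_shift. Qed.

(** The times at which a given link is active form one class modulo 1. Two such classes are either
    equal or separated, and there are finitely many pairs of links. *)
Lemma linked_gap : exists d, 0 < d /\ forall t t' i j k l,
  linked c r f g t i j -> linked c r f g t' k l -> t = t' \/ d <= Rabs (t - t').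
Proof.
pose P (x : 'I_n * 'I_n * ('I_n * 'I_n)) d := forall t t',
  linked c r f g t x.1.1 x.1.2 -> linked c r f g t' x.2.1 x.2.2 ->
  t = t' \/ d <= Rabs (t - t').
have [x d d' [_ d'd] Pd t t' tl t'l||d [d0 Pd]] := @uniform_eps _ P.
- by case: (Pd t t' tl t'l); [left | right; lra].
- move=> [[i j] [k l]]; rewrite /P /=.
  case: (pselect (adj c r i j /\ adj c r k l)) => [[ij kl]|no]; last first.
    exists 1; split=> [|t t' [ij _] [kl _]]; [lra | by case: no].
  have [u uE] := spos_link ij; have [v vE] := spos_link kl.
  have [d [d0 dP]] := translate_gap (u - v).
  exists d; split=> // t t' [_ te] [_ te'].
  have [m mE] : exists m : Z, t = u + IZR m by apply/(spos_eq i); rewrite te uE.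
  have [m' mE'] : exists m : Z, t' = v + IZR m by apply/(spos_eq k); rewrite te' vE.
  have <- : u - v + IZR (m - m') = t - t' by rewrite minus_IZR; lra.
  by case: (dP (m - m')%Z) => [|?]; [rewrite minus_IZR; left; lra | right].
by exists d; split=> // t t' i j k l; exact: (Pd (i, j, (k, l))).
Qed.

(** * The switching rule as an involution *)

(** A circle with no active link is fixed, by the default [i]. *)
Definition swap (t : R) (i : 'I_n) : 'I_n :=
  odflt i [pick j | `[< linked c r f g t i j >]].

Lemma swapP (t : R) (i : 'I_n) :
  linked c r f g t i (swap t i) \/ swap t i = i /\ forall j, ~ linked c r f g t i j.
Proof.
rewrite /swap; case: pickP => [j /asboolP|no] /=; first by left.
by right; split=> // j /asboolP; rewrite no.
Qed.

Lemma swap_linked (t : R) (i j : 'I_n) : linked c r f g t i j -> swap t i = j.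
Proof. by move=> ij; case: (swapP t i) => [/linked_fun/(_ ij)|[_ /(_ j)]]. Qed.

Lemma swapK (t : R) : involutive (swap t).
Proof.
by move=> i; case: (swapP t i) => [/linked_sym/swap_linked | [e _]] //; rewrite !e.
Qed.

Lemma swap_adj (t : R) (T : Type) (h : 'I_n -> T) (i : 'I_n) :
  (forall i j, adj c r i j -> h i = h j) -> h (swap t i) = h i.
Proof. by move=> hadj; case: (swapP t i) => [[/hadj-> _] | [-> _]]. Qed.

Lemma swap_shift (t : R) (m : Z) (i : 'I_n) : swap (t + IZR m) i = swap t i.
Proof.
by rewrite /swap; congr odflt; apply: eq_pick => j; apply: asbool_equiv_eq; exact: linked_shift.
Qed.

(* When both linked circles are occupied the robots stay put, which for occupancies
   is the same as exchanging them. *)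
Lemma switch_stepP (t : R) (S S' : {set 'I_n}) :
  switch_step c r f g t S S' <-> S' = swap t @: S.
Proof.
have swI := can_inj (@swapK t).
split=> [[sigma [inj [-> [move_ stay]]]]|->].
  have sE i : i \in S -> swap t i \notin S -> sigma i = swap t i.
    move=> iS sS; case: (move_ i iS) => [si|[/swap_linked-> //]].
    case: (swapP t i) => [il|[si' _]]; last by rewrite si' iS in sS.
    (* If the robot on [i] stayed, the empty linked circle would be taken by some [k]; but only the
       circle linked to it can send a robot there, so [k = i]. *)
    case: (stay i iS si _ il) => [|/imsetP[k kS kE]]; first by rewrite (negPf sS).
    case: (move_ k kS) => [kk|[]]; first by rewrite kE kk kS in sS.
    by rewrite -kE => /swap_linked/swI ki _; rewrite kE ki.
  have sS i : i \in S -> swap t i \in S -> sigma i = i.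
    move=> iS sS; case: (move_ i iS) => [//|[/swap_linked<-]].
    by rewrite sS.
  apply/setP => j; apply/imsetP/imsetP => -[i iS ->].
    case: (boolP (swap t i \in S)) => iS'; last by exists i; rewrite ?sE.
    by exists (swap t i) => //; rewrite swapK sS.
  case: (boolP (swap t i \in S)) => iS'; last by exists i; rewrite ?sE.
  by exists (swap t i) => //; rewrite sS ?swapK.
exists (fun i => if swap t i \in S then i else swap t i); split; last split; last split.
- move=> i j iS jS /=; case: ifP => si; case: ifP => sj // e.
  + by rewrite -e iS in sj.
  + by rewrite e jS in si.
  + exact: swI.
- apply/setP => j; apply/imsetP/imsetP => -[i iS ->].
    case: (boolP (swap t i \in S)) => iS'; last by exists i; rewrite ?(negPf iS').
    by exists (swap t i) => //; rewrite swapK iS.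
  case: ifP => iS'; last by exists i.
  by exists (swap t i); rewrite ?swapK.
- move=> i iS; case: ifP => iS'; [by left | right; split; last by rewrite iS'].
  by case: (swapP t i) => [//|[e _]]; rewrite e iS in iS'.
- move=> i iS; case: ifP => iS' e j ij; first by left; rewrite -(swap_linked ij).
  by rewrite e iS in iS'.
Qed.

(** * Composing the exchanges along a sequence of events *)

(** The recursion starts from the identity at 0 and also runs backwards, because each exchange is
    its own inverse. *)
Lemma iteratedZ (e : Z -> R) : exists rz : Z -> 'I_n -> 'I_n,
  (forall q, injective (rz q)) /\ forall q x, rz (q + 1)%Z x = swap (e q) (rz q x).
Proof.
have swI t := can_inj (swapK t).
pose up_ := fix up_ m x := if m is m'.+1 then swap (e (Z.of_nat m')) (up_ m' x) else x.
pose dn := fix dn m x := if m is m'.+1 then swap (e (- Z.of_nat m)%Z) (dn m' x) else x.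
exists (fun q => if (0 <=? q)%Z then up_ (Z.to_nat q) else dn (Z.to_nat (- q))).
split=> [q|q x].
  by case: ifP => _; [elim: (Z.to_nat q) | elim: (Z.to_nat (- q))] => //= m IH x y /swI/IH.
case: (Z.le_gt_cases 0 q) => q0.
  have [-> ->] : (0 <=? q)%Z = true /\ (0 <=? q + 1)%Z = true by split; apply/Z.leb_le; lia.
  have -> : Z.to_nat (q + 1) = (Z.to_nat q).+1 by lia.
  by rewrite /= Z2Nat.id.
have -> : (0 <=? q)%Z = false by apply/Z.leb_gt.
have -> : Z.to_nat (- q) = (Z.to_nat (- (q + 1))).+1 by lia.
have -> : dn (Z.to_nat (- (q + 1))).+1 x =
    swap (e (- Z.of_nat (Z.to_nat (- (q + 1))).+1)%Z) (dn (Z.to_nat (- (q + 1))) x) by [].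
have -> : (- Z.of_nat (Z.to_nat (- (q + 1))).+1 = q)%Z by lia.
rewrite swapK; case: (Z.le_gt_cases 0 (q + 1)) => q1; last first.
  by have -> : (0 <=? q + 1)%Z = false by apply/Z.leb_gt.
by have -> : (q + 1 = 0)%Z by lia.
Qed.

(** A window of length [d] contains at most one event time. [e q] is that time, or the left end of
    an eventless window; such extra times are harmless, since the exchange there is the identity. *)
Lemma event_sequence : exists e : Z -> R,
  (forall p q, (p < q)%Z -> e p < e q) /\
  (forall t, exists q, e (q - 1)%Z <= t < e q) /\
  (forall t i j, linked c r f g t i j -> exists q, t = e q).
Proof.
have [d [d0 gap]] := linked_gap.
have /choice[e eP] : forall q, exists e, IZR q * d <= e < (IZR q + 1) * d /\
    forall t i j, linked c r f g t i j -> IZR q * d <= t < (IZR q + 1) * d -> t = e.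
  move=> q.
  case: (pselect (exists t i j, linked c r f g t i j /\ IZR q * d <= t < (IZR q + 1) * d)).
    move=> [t [i [j [tl tw]]]]; exists t; split=> // t' i' j' tl' tw'.
    have [//|] := gap _ _ _ _ _ _ tl' tl.
    by have := Rabs_def1 (t' - t) d; lra.
  move=> no; exists (IZR q * d); split=> [|t i j tl tw]; first by lra.
  by case: no; exists t, i, j.
have window t : exists q, IZR q * d <= t < (IZR q + 1) * d.
  have [q [ql qu]] := floor_spec (t / d); exists q.
  have -> : t = t / d * d by field; lra.
  by split; [apply: Rmult_le_compat_r | apply: Rmult_lt_compat_r]; lra.
have incr p q : (p < q)%Z -> e p < e q.
  move=> pq; have [[_ pu] _] := eP p; have [[ql _] _] := eP q.
  have : IZR p + 1 <= IZR q by rewrite -plus_IZR; apply: IZR_le; lia.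
  by move=> /(Rmult_le_compat_r d) -/(_ (Rlt_le _ _ d0)); lra.
exists e; split=> //; split=> [t|t i j tl]; have [q tq] := window t; last first.
  by exists q; apply: (proj2 (eP q)) tl tq.
(* The index depends on whether [t] precedes the marked time of its own window. *)
case: (Rlt_le_dec t (e q)) => te; [exists q | exists (q + 1)%Z]; split=> //.
- have [[_ +] _] := eP (q - 1)%Z; rewrite minus_IZR; lra.
- by have -> : (q + 1 - 1 = q)%Z by lia.
- have [[+ _] _] := eP (q + 1)%Z; rewrite plus_IZR; lra.
Qed.
End Schedule.
(* [rho b t x] is the circle on which the token labelled [x] is just before ([b = false])
   or just after ([b = true]) time [t]; [mu] is the monodromy over one period. *)
Definition evolution (n : nat) (c : 'I_n -> point) (r : R) (f g : 'I_n -> R)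
    (rho : bool -> R -> 'I_n -> 'I_n) (mu : 'I_n -> 'I_n) : Prop :=
  [/\ forall b t, injective (rho b t),
      forall b t x, rho (~~ b) t x = swap c r f g t (rho b t x),
      forall t, exists eps, 0 < eps /\ forall b x s,
        (t < s < t + eps -> rho b s x = rho true t x) /\
        (t - eps < s < t -> rho b s x = rho false t x) &
      forall b t x, rho b (t + 1) x = rho b t (mu x)].

(** * The token flow and its monodromy *)

Section Evolution.

Variables (n : nat) (c : 'I_n -> point) (r : R).
Hypothesis sysP : valid_system c r.
Variables f g : 'I_n -> R.
Hypothesis syncP : is_sync_schedule c r f g.

Local Notation swap := (swap c r f g).
Let swapI t : injective (swap t) := can_inj (swapK sysP syncP t).

(** [h x t] is the token that occupies at time [t] the circle where [x] is one period later. The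
    same exchanges act at [t] and [t + 1], so it is locally constant in [t], hence constant. *)
Lemma monodromy_exists (rho : bool -> R -> 'I_n -> 'I_n) :
  (forall b t, injective (rho b t)) ->
  (forall b t x, rho (~~ b) t x = swap t (rho b t x)) ->
  (forall t, exists eps, 0 < eps /\ forall b x s,
     (t < s < t + eps -> rho b s x = rho true t x) /\
     (t - eps < s < t -> rho b s x = rho false t x)) ->
  exists mu, evolution c r f g rho mu.
Proof.
move=> inj hop loc.
pose h x t := finv (rho true t) (rho true (t + 1) x).
have hE x t : rho true t (h x t) = rho true (t + 1) x by rewrite f_finv.
have hE' x t : rho false t (h x t) = rho false (t + 1) x.
  by rewrite !(hop true) hE -(swap_shift syncP t 1).
exists (h^~ 0); split=> // b t x.
have -> : h x 0 = h x t.
  apply: locally_constant2 => {}t.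
  have [d [d0 locd]] := loc t; have [e [e0 loce]] := loc (t + 1).
  exists (Rmin d e); split=> [|s st]; first by apply: Rmin_glb_lt.
  have := Rmin_l d e; have := Rmin_r d e => ? ?.
  apply: (inj true s); rewrite hE.
  have [lt|[->|gt]] := Rtotal_order s t; last 2 first.
  - by rewrite hE.
  - by rewrite (proj1 (locd true (h x t) s)) ?(proj1 (loce true x (s + 1))) ?hE //; lra.
  - by rewrite (proj2 (locd true (h x t) s)) ?(proj2 (loce true x (s + 1))) ?hE' //; lra.
by case: b; rewrite ?hE ?hE'.
Qed.

Lemma evolution_exists : exists rho mu, evolution c r f g rho mu.
Proof.
have [e [incr [cover events]]] := event_sequence sysP syncP.
have [rz [rzI rzS]] := iteratedZ sysP syncP e.
(* An event time belongs to the later interval for the state after it, and to the earlier one for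
   the state before it. *)
pose between b t q := if b then e (q - 1)%Z <= t < e q else e (q - 1)%Z < t <= e q.
have /choice[q1 q1P] : forall t, exists q, between true t q by [].
have q0P t : exists q, between false t q.
  have /= tq := q1P t; case: (Req_dec (e (q1 t - 1)%Z) t) => te.
    exists (q1 t - 1)%Z; split; last by lra.
    by have := incr (q1 t - 1 - 1)%Z (q1 t - 1)%Z ltac:(lia); lra.
  by exists (q1 t); split; lra.
have /choice[q0 {}q0P] := q0P.
have le p q : (p <= q)%Z -> e p <= e q.
  by case/Z.le_lteq => [/incr ? | ->]; lra.
have between_uniq b t p q : between b t p -> between b t q -> p = q.
  move=> tp tq; case: (Z.lt_trichotomy p q) => [pq|[//|qp]].
    by have := le p (q - 1)%Z; case: b tp tq => /= ? ? /(_ ltac:(lia)); lra.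
  by have := le q (p - 1)%Z; case: b tp tq => /= ? ? /(_ ltac:(lia)); lra.
pose rho (b : bool) t := rz (if b then q1 t else q0 t).
have rhoE b t q x : between b t q -> rho b t x = rz q x.
  by move=> tq; rewrite /rho (between_uniq b t q (if b then q1 t else q0 t)) //; case: b {tq}.
exists rho; apply: monodromy_exists.
- by move=> b t; exact: rzI.
- have hop t x : rho true t x = swap t (rho false t x).
    have [t0 t1] := q0P t; case: (Req_dec t (e (q0 t))) => te.
      have bt : between true t (q0 t + 1)%Z.
        split; first by rewrite Z.add_simpl_r; lra.
        by have := incr (q0 t) (q0 t + 1)%Z ltac:(lia); lra.
      by rewrite (rhoE _ _ _ _ bt) rzS /rho -te.
    (* Here [t] lies strictly between consecutive marked times, so no link is active and the
       exchange is trivial. *)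
    rewrite (@rhoE true t (q0 t)); last by split; lra.
    case: (swapP c r f g t (rho false t x)) => [/events[p tp]|[-> //]].
    have p0 : (p < q0 t)%Z.
      by case: (Z.lt_ge_cases p (q0 t)) => // /le; lra.
    by have := le p (q0 t - 1)%Z ltac:(lia); lra.
  by move=> [] t x //=; rewrite hop swapK.
- move=> t; have [t1 t1'] := q1P t; have [t0 t0'] := q0P t.
  exists (Rmin (e (q1 t) - t) (t - e (q0 t - 1)%Z)); split=> [|b x s].
    by apply: Rmin_glb_lt; lra.
  have := Rmin_l (e (q1 t) - t) (t - e (q0 t - 1)%Z).
  have := Rmin_r (e (q1 t) - t) (t - e (q0 t - 1)%Z) => ? ?.
  by split=> ts; apply: rhoE; case: b; split; lra.
Qed.

(** Tokens move only along edges, so each stays in its connected component, on which [h] is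
    constant. *)
Lemma evolution_component (rho : bool -> R -> 'I_n -> 'I_n) (mu : 'I_n -> 'I_n)
    (T : Type) (h : 'I_n -> T) :
  evolution c r f g rho mu -> (forall i j, adj c r i j -> h i = h j) ->
  forall b t x, h (rho b t x) = h (rho true 0 x).
Proof.
move=> [inj hop loc _] hadj b t x.
have side b' u : h (rho b' u x) = h (rho true u x).
  by case: b' => //; rewrite (hop true) (swap_adj f g u _ hadj).
rewrite side; apply: (@locally_constant2 _ (fun u => h (rho true u x))) => {}t.
have [d [d0 locd]] := loc t; exists d; split=> // s st.
have [lt|[->|gt]] := Rtotal_order s t => //.
- by rewrite (proj2 (locd true x s)) ?side //; lra.
- by rewrite (proj1 (locd true x s)) ?side //; lra.
Qed.

Lemma evolution_iter (rho : bool -> R -> 'I_n -> 'I_n) (mu : 'I_n -> 'I_n) :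
  evolution c r f g rho mu ->
  forall m b t x, rho b (t + INR m) x = rho b t (iter m mu x).
Proof.
move=> [_ _ _ per] m b t x; elim: m => [|m IH] in x *; first by rewrite Rplus_0_r.
by rewrite S_INR -Rplus_assoc per IH iterSr.
Qed.

Lemma monodromy_inj (rho : bool -> R -> 'I_n -> 'I_n) (mu : 'I_n -> 'I_n) :
  evolution c r f g rho mu -> injective mu.
Proof.
by move=> [inj _ _ per] x y xy; apply: (inj true (0 + 1)); rewrite !per xy.
Qed.

(** * Survival in terms of the orbits of the monodromy *)

Section Survival.

Variables (rho : bool -> R -> 'I_n -> 'I_n) (mu : 'I_n -> 'I_n).
Hypothesis evolP : evolution c r f g rho mu.

(** Once no robot leaves, occupancies change by exchanges alone, just as the tokens do, so the set
    of tokens carrying robots is constant. *)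
Lemma run_without_departures (st : R -> {set 'I_n}) (T : R) (m : nat) :
  scs_run c r f g st -> 0 <= T -> (forall t, T <= t -> #|st t| = m) ->
  forall t, T <= t -> rho true t @^-1: st t = rho true T @^-1: st T.
Proof.
move=> [right_ switch] T0 card; have [inj hop loc _] := evolP.
apply: locally_constant => t tT; have [d [d0 locd]] := loc t.
  have [e [e0 ste]] := right_ t ltac:(lra).
  exists (Rmin d e); split=> [|s ts]; first by apply: Rmin_glb_lt.
  have := Rmin_l d e; have := Rmin_r d e => ? ?.
  rewrite ste; last by lra.
  case: (Req_dec s t) => [-> //|st']; apply/setP => x; rewrite !inE.
  by rewrite (proj1 (locd true x s)) //; lra.
have [S [before [L1 [L2 [S1 [/(switch_stepP sysP syncP)-> stE]]]]]] := switch t ltac:(lra).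
case: before => [[]|[_ [e [e0 stS]]]]; first by lra.
(* The new occupancy is included in the exchanged one and has the same size, so the departure sets
   remove nothing. *)
have stT : st t = swap t @: S.
  apply/eqP; rewrite eqEcard stE; apply/andP; split.
    by apply: subset_trans (subsetDl _ _) (imsetS _ (subsetDl _ _)).
  rewrite -stE card; last by lra.
  rewrite card_imset //; have := Rmax_l T (t - e / 2); have := Rmax_r T (t - e / 2).
  have ? : Rmax T (t - e / 2) < t by apply: Rmax_lub_lt; lra.
  by move=> ? ?; rewrite -(stS (Rmax T (t - e / 2))) ?card //; lra.
exists (Rmin d e); split=> [|s sT ts]; first by apply: Rmin_glb_lt.
have := Rmin_l d e; have := Rmin_r d e => ? ?.
apply/setP => x; rewrite !inE stT stS; last by lra.
rewrite (proj2 (locd true x s)); last by lra.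
by rewrite (hop false) mem_imset.
Qed.

(** The robots outside [B] all leave at time 0, just after the first switching. *)
Lemma evolution_run (B : {set 'I_n}) : scs_run c r f g (fun t => rho true t @: B).
Proof.
have [inj hop loc _] := evolP; split=> t t0; have [d [d0 locd]] := loc t.
  exists d; split=> // s ts; case: (Req_dec s t) => [-> //|st].
  by apply: eq_imset => x; apply: (proj1 (locd true x s)); lra.
case: (Req_dec t 0) => [->|tn0].
  exists setT; split; first by left.
  exists set0, (~: (rho true 0 @: B)), setT; split.
    apply/(switch_stepP sysP syncP); rewrite setD0; apply/setP => i; rewrite inE.
    by rewrite -(swapK sysP syncP 0 i) mem_imset ?inE.
  by rewrite setDE setCK setTI.
exists (rho false t @: B); split.
  right; split; first by lra.
  exists d; split=> // s ts.
  by apply: eq_imset => x; apply: (proj2 (locd true x s)); lra.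
exists set0, set0, (rho true t @: B); rewrite !setD0; split=> //.
apply/(switch_stepP sysP syncP); rewrite -imset_comp.
by apply: eq_imset => x; rewrite /= -hop.
Qed.

(** An orbit of size at most [k] can be emptied, which leaves some point of a circle unvisited.
    Conversely, [n - k] survivors cannot avoid an orbit with more than [k] tokens, and any survivor
    in it takes the place of each of its tokens in turn. *)
Lemma survivesP (k : nat) : survives c r f g k <-> forall x, (k < order mu x)%N.
Proof.
have [inj hop loc per] := evolP; have muI := monodromy_inj evolP.
split=> [surv x|big st run [T0 [T00 card]] i a T].
  rewrite ltnNge; apply/negP => small.
  set orb := [set y | fconnect mu x y].
  have orbE : #|orb| = order mu x by rewrite cardsE.
  have [B [cB Borb]] : exists B : {set 'I_n}, #|B| = (n - k)%N /\ B \subset ~: orb.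
    exists [set y in take (n - k) (enum (~: orb))]; split.
      rewrite cardsE (card_uniqP (take_uniq _ (enum_uniq _))) size_takel //.
      by rewrite -cardE [#|~: _|]cardsCs setCK orbE card_ord leq_sub2l.
    by apply/subsetP => y; rewrite inE => /mem_take; rewrite mem_enum.
  have dep : departures (fun t => rho true t @: B) k.
    by exists 0; split=> [|t _]; [lra | rewrite card_imset].
  (* At [s] no exchange occurs, so the states before and after agree there and at its integer
     translates. The point tested is the one reached on that circle at [s]. *)
  have [d [d0 locd]] := loc 0; set s := d / 2.
  have sd : 0 < s < d by rewrite /s; lra.
  have [t [ts [tE mem]]] := surv _ (evolution_run B) dep (rho true 0 x)
    (f (rho true 0 x) + g (rho true 0 x) * 2 * PI * s) s.
  have [m mE] := proj1 (spos_eq syncP (rho true 0 x) t s) tE.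
  have m0 : (0 <= m)%Z by apply: le_IZR; lra.
  have [b /imsetP[y yB]] : exists b, rho true 0 x \in rho b t @: B.
    case: mem => [?|[S [before SE]]]; first by exists true.
    exists false; case: before => [[]|[_ [e [e0 stS]]]]; first by lra.
    have [u [u0 locu]] := loc t.
    have := Rmin_l u e; have := Rmin_r u e => ? ?.
    have ? : 0 < Rmin u e by apply: Rmin_glb_lt.
    rewrite -(stS (t - Rmin u e / 2)) in SE; last by lra.
    have /eq_imset<- // : rho true (t - Rmin u e / 2) =1 rho false t.
    by move=> y; apply: (proj2 (locu true y _)); lra.
  rewrite mE -(Z2Nat.id m) // -INR_IZR_INZ (evolution_iter evolP).
  rewrite (proj1 (locd b _ s)); last by lra.
  move=> /inj xE; have := subsetP Borb y yB.
  by rewrite !inE fconnect_sym // xE fconnect_iter.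
set B := rho true T0 @^-1: st T0.
have BE t : T0 <= t -> rho true t @^-1: st t = B.
  exact: run_without_departures run T00 card t.
have cB : #|B| = (n - k)%N.
  rewrite -(card T0 (Rle_refl _)) on_card_preimset //.
  by apply: onW_bij; apply: injF_bij; exact: inj.
have [t0 t0E] := spos_surj syncP i a.
have [m [_ mT]] := floor_spec (Rmax T T0 - t0).
have := Rmax_l T T0; have := Rmax_r T T0 => ? ?.
set t1 := t0 + IZR (m + 1).
have t1T : Rmax T T0 <= t1 by rewrite /t1 plus_IZR; lra.
set x := finv (rho true t1) i.
(* Counting: [B] has [n - k] tokens, more than lie outside the orbit of [x]. *)
have /subsetPn[y] : ~~ (B \subset ~: [set y | fconnect mu x y]).
  apply/negP => /subset_leq_card; rewrite cB [#|~: _|]cardsCs setCK card_ord cardsE.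
  have := big x; rewrite -/(order mu x) => kx.
  have := max_card (fconnect mu x); rewrite card_ord -/(order mu x) => xn.
  by rewrite leqNgt ltn_sub2l // (leq_trans kx).
move=> yB; rewrite !inE negbK fconnect_sym // => /iter_findex yx.
(* After [q] further periods the surviving token [y] is where [x] was at [t1], namely on [i], at the
   same angle. *)
set q := findex mu y x in yx; exists (t1 + INR q); have := pos_INR q => q0.
split; first by lra.
split; first by rewrite INR_IZR_INZ !(spos_shift syncP).
left; move: yB; rewrite -(BE (t1 + INR q)); last by lra.
by rewrite inE (evolution_iter evolP) yx f_finv.
Qed.

End Survival.
End Evolution.

(** * Comparing two schedules by a change of clock *)

Definition retime (p : bool * R) (t : R) : R := (if p.1 then - t else t) + p.2.

Section Transport.

Variables (n : nat) (c : 'I_n -> point) (r : R).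
Hypothesis sysP : valid_system c r.
Variables f1 g1 f2 g2 : 'I_n -> R.
Hypotheses (sync1 : is_sync_schedule c r f1 g1) (sync2 : is_sync_schedule c r f2 g2).

(* For an edge [ij] both schedules reach the link [ij] on [i] exactly when they reach
   [ji] on [j], so the clock change from [f2] to [f1] is the same on [i] and [j], modulo a
   period. *)
Lemma sync_retime : exists h : 'I_n -> bool * R,
  (forall i j, adj c r i j -> h i = h j) /\
  forall i t, spos c f2 g2 i t = spos c f1 g1 i (retime (h i) t).
Proof.
have pi0 := PI_RGT_0.
have /choice[p pP] : forall i, exists p : bool * R,
    (p.1 <-> g1 i = - g2 i) /\ forall t, spos c f2 g2 i t = spos c f1 g1 i (retime p t).
  move=> i; rewrite /spos /retime.
  case: (dirP sync1 i) => ->; case: (dirP sync2 i) => ->.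
  - exists (false, (f2 i - f1 i) / (2 * PI)); split=> [|t]; first by split=> //; lra.
    by congr circ_pt => /=; field; lra.
  - exists (true, (f2 i - f1 i) / (2 * PI)); split=> [|t]; first by split=> //; lra.
    by congr circ_pt => /=; field; lra.
  - exists (true, (f1 i - f2 i) / (2 * PI)); split=> [|t]; first by split=> //; lra.
    by congr circ_pt => /=; field; lra.
  - exists (false, (f1 i - f2 i) / (2 * PI)); split=> [|t]; first by split=> //; lra.
    by congr circ_pt => /=; field; lra.
pose same i j := (p i).1 = (p j).1 /\ exists m : Z, (p j).2 = (p i).2 + IZR m.
have adj_same i j : adj c r i j -> same i j.
  move=> ij; have [g1ij _] := proj2 sync1 _ _ ij; have [g2ij _] := proj2 sync2 _ _ ij.
  have s : (p i).1 = (p j).1.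
    by apply/idP/idP => /(proj1 (pP _)) ?; apply/(proj1 (pP _)); lra.
  split=> //.
  have [t tE] := spos_link sysP sync2 ij; have tE' := link_sync sync2 ij tE.
  rewrite (proj2 (pP _)) in tE; rewrite (proj2 (pP _)) in tE'.
  have := link_sync sync1 ij tE; rewrite -tE' => /(spos_eq sync1)[m].
  by rewrite /retime s => mE; exists (- m)%Z; rewrite opp_IZR; lra.
(* Neighbouring clocks agree only modulo an integer; taking the clock of a root of each component
   makes them equal, and periodicity absorbs the difference. *)
pose e := [rel i j : 'I_n | `[< adj c r i j >]].
have e_sym : connect_sym e.
  by apply: sym_connect_sym => i j; apply: asbool_equiv_eq; split; exact: adj_sym.
have connect_same i j : connect e i j -> same i j.
  move=> /connectP[s + ->]; elim: s i => [|k s IH] i /=.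
    by split=> //; exists 0%Z; lra.
  case/andP=> /asboolP/adj_same[ik [m mE]] /IH[kj [m' mE']].
  by split; [rewrite ik | exists (m + m')%Z; rewrite plus_IZR mE' mE Rplus_assoc].
exists (fun i => p (root e i)); split=> [i j ij|i t].
  by congr p; apply/(rootP e_sym)/connect1/asboolP.
rewrite (proj2 (pP i)); have [s [m mE]] := connect_same _ _ (connect_root e i).
apply/(spos_eq sync1); exists (- m)%Z; rewrite /retime s opp_IZR; lra.
Qed.

(** Each token follows the old flow on the clock of its component. A reversed clock exchanges before
    and after, hence the [(+)] in [rho'], and inverts the monodromy, which preserves orbits. *)
Lemma evolution_transport (rho : bool -> R -> 'I_n -> 'I_n) (mu : 'I_n -> 'I_n) :
  evolution c r f1 g1 rho mu ->
  exists rho' mu', evolution c r f2 g2 rho' mu' /\ forall x, order mu' x = order mu x.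
Proof.
move=> ev; have [inj hop loc per] := ev; have muI := monodromy_inj ev.
have [h [hadj retimeP]] := sync_retime.
have hrho := evolution_component ev hadj.
pose p x := h (rho true 0 x).
have pmu x : p (mu x) = p x by rewrite /p -per hrho.
have pmu' x : p (finv mu x) = p x by rewrite -{2}(f_finv muI x) pmu.
pose rho' b t x := rho (b (+) (p x).1) (retime (p x) t) x.
pose mu' x := if (p x).1 then finv mu x else mu x.
have pmuE x : p (mu' x) = p x by rewrite /mu'; case: ifP.
have ev' : evolution c r f2 g2 rho' mu'.
  split.
  - move=> b t x y xy; have pxy : p x = p y.
      (* Tokens on the same circle lie in the same component, so they share a clock and injectivity
         of the old flow applies. *)
      by have := congr1 h xy; rewrite /rho' !hrho.
    by move: xy; rewrite /rho' pxy => /inj.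
  - move=> b t x; rewrite /rho' addNb hop /swap; congr odflt; apply: eq_pick => j.
    by apply: asbool_equiv_eq; rewrite /linked retimeP hrho.
  - move=> t.
    pose near x d := forall b s, (t < s < t + d -> rho' b s x = rho' true t x) /\
      (t - d < s < t -> rho' b s x = rho' false t x).
    have [x d d' [_ d'd] nx b s|x|d [d0 dP]] := @uniform_eps _ near; last 1 first.
    + by exists d; split=> // b x s; exact: dP.
    + by have [after before] := nx b s; split=> ?; [apply: after | apply: before]; lra.
    have [d [d0 locd]] := loc (retime (p x) t); exists d; split=> // b s.
    have [after before] := locd (b (+) (p x).1) x (retime (p x) s).
    move: after before; rewrite /rho' /retime.
    by case: (p x).1 => /= after before; split=> ?; [apply: before| apply: after | apply: after | apply: before]; lra.
  - move=> b t x; rewrite /rho' pmuE /mu' /retime; case: (p x).1.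
      have -> : - t + (p x).2 = - (t + 1) + (p x).2 + 1 by ring.
      by rewrite per f_finv.
    by rewrite -per; congr rho; ring.
have mu'I := monodromy_inj ev'.
have sub1 : subrel (fconnect mu') (fconnect mu).
  apply: connect_sub => u v /eqP<-; rewrite /mu'.
  by case: ifP => _; [exact: fconnect_finv | exact: fconnect1].
have sub2 : subrel (fconnect mu) (fconnect mu').
  apply: connect_sub => u v /eqP<-; case pu: (p u).1.
    have uE : mu' (mu u) = u by rewrite /mu' pmu pu finv_f.
    by rewrite fconnect_sym // -{2}uE fconnect1.
  have <- : mu' u = mu u by rewrite /mu' pu.
  exact: fconnect1.
exists rho', mu'; split=> // x; apply: eq_card => y.
by apply/idP/idP; [exact: sub1 | exact: sub2].
Qed.

End Transport.

Theorem theorem4 (n : nat) (c : 'I_n -> point) (r : R)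
  (f1 g1 f2 g2 : 'I_n -> R) :
  valid_system c r ->
  is_sync_schedule c r f1 g1 ->
  is_sync_schedule c r f2 g2 ->
  (f1, g1) <> (f2, g2) ->
  forall k : nat,
    is_uncovering_resilience c r f1 g1 k <-> is_uncovering_resilience c r f2 g2 k.
Proof.
move=> sysP sync1 sync2 _ k.
have [rho1 [mu1 ev1]] := evolution_exists sysP sync1.
have [rho2 [mu2 [ev2 orderE]]] := evolution_transport sysP sync1 sync2 ev1.
have survE k' : survives c r f1 g1 k' <-> survives c r f2 g2 k'.
  rewrite (survivesP sysP sync1 ev1) (survivesP sysP sync2 ev2).
  by split=> big x; have := big x; rewrite orderE.
rewrite /is_uncovering_resilience survE.
by split=> -[kn [sk kmax]]; split=> //; split=> // k' k'n /survE; exact: kmax.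
Qed.
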